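(* Let $E$ be a Banach lattice. If $E$ has a strong unit, then the weak topology $\tau_w$ of $E$ and the $wun$-topology $\tau_{wun}$ of $E$ coincide.
   Context: A net $(x_\alpha)$ in a Banach lattice $E$ is $un$-convergent to $x$ if $\| |x_\alpha - x| \wedge u \| \to 0$ for every $u \in E^+$. A linear functional $f:E\to\mathbb{R}$ is $un$-continuous if $f(x_\alpha)\to 0$ for every norm bounded net $(x_\alpha)\subseteq E$ that is $un$-convergent to $0$. The $un$-dual $E^{\diamond}\subseteq E^*$ is the vector space of all $un$-continuous functionals on $E$. The $wun$-topology (weakly unbounded norm topology) $\tau_{wun}$ is the smallest topology on $E$ for which every $f\in E^{\diamond}$ is continuous. An element $e\in E^+$ is a strong unit if for every $x\ge 0$ in $E$ there is $n\in\mathbb{N}$ with $x\le ne$. *)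

(* Defs.v *)
From HB Require Import structures.
From mathcomp Require Import all_boot all_order all_algebra.
From mathcomp Require Import all_classical all_reals all_analysis.

Set Implicit Arguments.
Unset Strict Implicit.
Unset Printing Implicit Defensive.

Import Order.TTheory GRing.Theory Num.Theory.
Import numFieldNormedType.Exports.

Local Open Scope classical_set_scope.
Local Open Scope ring_scope.

Reserved Notation "x <=v y" (at level 70, y at next level).

(* Hierarchy-Builder rejects the join of CompleteNormedModule with
   Order.Lattice: RealDomain already inherits from Zmodule and Lattice, and
   no smallest common structure is declared.  The lattice order is therefore
   a separate relation on the normed module. *)
HB.mixin Record CompleteNormedModule_isBanachLattice (R : realType) E
    & CompleteNormedModule R E := {
  vle : rel E ;
  vmeet : E -> E -> E ;
  vjoin : E -> E -> E ;
  vle_refl : reflexive vle ;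
  vle_anti : antisymmetric vle ;
  vle_trans : transitive vle ;
  vleI : forall x y z : E, vle x (vmeet y z) = vle x y && vle x z ;
  vleU : forall x y z : E, vle (vjoin x y) z = vle x z && vle y z ;
  vleD2r : forall z x y : E, vle x y -> vle (x + z) (y + z) ;
  vscale_ge0 : forall (a : R) (x : E), 0 <= a -> vle 0 x -> vle 0 (a *: x) ;
  vle_norm : forall x y : E,
    vle (vjoin x (- x)) (vjoin y (- y)) -> `|x| <= `|y|
}.

#[short(type="banachLatticeType")]
HB.structure Definition BanachLattice (R : realType) :=
  { E of CompleteNormedModule R E
    & CompleteNormedModule_isBanachLattice R E }.

Notation "x <=v y" := (vle x y) : ring_scope.

Definition vabs {R : realType} {E : banachLatticeType R} (x : E) : E :=
  vjoin x (- x).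

Definition strong_unit {R : realType} {E : banachLatticeType R} (e : E) :=
  0 <=v e /\ forall x : E, 0 <=v x -> exists n : nat, x <=v e *+ n.

(* A net in E is a function from a nonempty directed preorder (I, le); its
   limits are taken along the filter generated by the tails of I. *)
Definition directed (I : Type) (le : I -> I -> Prop) :=
  [/\ inhabited I,
      forall i, le i i,
      forall i j k, le i j -> le j k -> le i k &
      forall i j, exists2 k, le i k & le j k].

Definition tails (I : Type) (le : I -> I -> Prop) : set_system I :=
  [set A | exists i, forall j, le i j -> A j].

Definition un_cvg {R : realType} {E : banachLatticeType R} (I : Type)
    (le : I -> I -> Prop) (x : I -> E) (l : E) :=
  forall u : E, 0 <=v u ->
    `|vmeet (vabs (x i - l)) u| @[i --> tails le] --> (0 : R).

Definition un_continuous {R : realType} {E : banachLatticeType R}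
    (f : E -> R) :=
  forall (I : Type) (le : I -> I -> Prop) (x : I -> E),
    directed le -> (exists M : R, forall i, `|x i| <= M) ->
    un_cvg le x 0 -> f (x i) @[i --> tails le] --> (0 : R).

Definition norm_dual {R : realType} (E : banachLatticeType R) :
    set {linear E -> R^o} :=
  [set f | continuous f].
Arguments norm_dual {R} E.

Definition un_dual {R : realType} (E : banachLatticeType R) :
    set {linear E -> R^o} :=
  [set f | un_continuous f].
Arguments un_dual {R} E.

(* The smallest topology on E making every functional in Phi continuous. *)
Definition functional_topology {R : realType} {E : banachLatticeType R}
    (Phi : set {linear E -> R^o}) : topologicalType :=
  sup_topology (fun f : {f : {linear E -> R^o} | Phi f} =>
    Topological.on (initial_topology (projT1 f : E -> R^o))).

Definition tau_w {R : realType} (E : banachLatticeType R) : set_system E :=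
  @open (functional_topology (norm_dual E)).
Arguments tau_w {R} E.

Definition tau_wun {R : realType} (E : banachLatticeType R) : set_system E :=
  @open (functional_topology (un_dual E)).
Arguments tau_wun {R} E.

(* Main.v *)
(** A strong unit [e] dominates the unit ball up to a scalar.  Otherwise there
    are positive [y_n] of norm at most [2^-n] with [y_n] not below [n e]; their
    sum converges to some [y] above every [y_n], and [y <= N e] for some [N]
    contradicts the choice of [y_N].  Hence a norm bounded net satisfies
    [|x_i| <= K e] for some [K >= 1], so that [|x_i| <= K (|x_i| /\ e)]: on
    norm bounded nets un-convergence is norm convergence, and the norm dual and
    the un-dual are the same set of functionals. *)
Require Import Defs.
From mathcomp Require Import all_boot all_order all_algebra.
From mathcomp Require Import all_classical all_reals all_analysis.

Set Implicit Arguments.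
Unset Strict Implicit.
Unset Printing Implicit Defensive.

Import Order.TTheory GRing.Theory Num.Theory.
Import numFieldNormedType.Exports.

Local Open Scope classical_set_scope.
Local Open Scope ring_scope.

(** * Order, norm and strong units in a Banach lattice *)

Section BanachLatticeTheory.
Context {R : realType} {E : banachLatticeType R}.
Implicit Types (x y z e : E) (a : R).

Lemma vle_antisym x y : x <=v y -> y <=v x -> x = y.
Proof. by move=> xy yx; apply: vle_anti; rewrite xy yx. Qed.

Lemma vleD2rE z x y : (x + z <=v y + z) = (x <=v y).
Proof.
apply/idP/idP => [/(vleD2r (- z))|]; last exact: vleD2r.
by rewrite !addrK.
Qed.

Lemma vsub_ge0 x y : (0 <=v y - x) = (x <=v y).
Proof. by rewrite -(vleD2rE x) add0r subrK. Qed.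

Lemma vleD x1 x2 y1 y2 : x1 <=v y1 -> x2 <=v y2 -> x1 + x2 <=v y1 + y2.
Proof.
move=> xy1 xy2; apply: (@vle_trans _ _ (y1 + x2)); first exact: vleD2r.
by rewrite ![y1 + _]addrC; exact: vleD2r.
Qed.

Lemma vle_scale a x y : 0 <= a -> x <=v y -> a *: x <=v a *: y.
Proof.
move=> a0; rewrite -vsub_ge0 => xy.
by rewrite -vsub_ge0 -scalerBr; exact: vscale_ge0.
Qed.

Lemma vle_scaler a b x : a <= b -> 0 <=v x -> a *: x <=v b *: x.
Proof.
move=> ab x0; rewrite -vsub_ge0 -scalerBl.
by apply: vscale_ge0 => //; rewrite subr_ge0.
Qed.

Lemma vsum_ge0 (I : Type) (r : seq I) (P : pred I) (F : I -> E) :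
  (forall i, P i -> 0 <=v F i) -> 0 <=v \sum_(i <- r | P i) F i.
Proof.
move=> F0; apply: (big_ind (fun x => 0 <=v x)) => // [|x y x0 y0].
  exact: vle_refl.
by rewrite -[0]addr0; exact: vleD.
Qed.

Lemma vleUl x y : x <=v vjoin x y.
Proof. by have := vle_refl (vjoin x y); rewrite vleU => /andP[]. Qed.

Lemma vleUr x y : y <=v vjoin x y.
Proof. by have := vle_refl (vjoin x y); rewrite vleU => /andP[]. Qed.

Lemma vleIl x y : vmeet x y <=v x.
Proof. by have := vle_refl (vmeet x y); rewrite vleI => /andP[]. Qed.

(** Adding [x <=v vabs x] and [- x <=v vabs x] gives [0 <=v vabs x + vabs x], which is then
    halved. *)
Lemma vabs_ge0 x : 0 <=v vabs x.
Proof.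
have h2 : 0 <=v vabs x + vabs x.
  by rewrite -(subrr x); apply: vleD; [exact: vleUl|exact: vleUr].
rewrite -[vabs x]scale1r -(@mulVf R 2) ?pnatr_eq0 // -scalerA scaler_nat mulr2n.
by apply: vscale_ge0 => //; rewrite invr_ge0.
Qed.

Lemma ge0_vabs x : 0 <=v x -> vabs x = x.
Proof.
move=> x0; apply: vle_antisym; last exact: vleUl.
rewrite vleU vle_refl /=; apply: vle_trans (x0).
by rewrite -vsub_ge0 sub0r opprK.
Qed.

Lemma vabs_idem x : vabs (vabs x) = vabs x.
Proof. exact/ge0_vabs/vabs_ge0. Qed.

Lemma norm_vabs x : `|vabs x| = `|x|.
Proof.
apply/eqP; rewrite eq_le; apply/andP.
by split; apply: vle_norm; rewrite -!/(vabs _) vabs_idem; exact: vle_refl.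
Qed.

Lemma vle_norm_ge0 x y : 0 <=v x -> x <=v y -> `|x| <= `|y|.
Proof.
move=> x0 xy; apply: vle_norm; rewrite -!/(vabs _) !ge0_vabs //.
exact: vle_trans xy.
Qed.

Lemma vmeet_ge0 x y : 0 <=v x -> 0 <=v y -> 0 <=v vmeet x y.
Proof. by rewrite vleI => -> ->. Qed.

(** The negative part [yn] of the limit lies below [vabs (x i - y)] as soon as [x i] is positive, so
    its norm is arbitrarily small. *)
Lemma vpos_closed (I : Type) (F : set_system I) (FF : ProperFilter F)
    (x : I -> E) y :
  x @ F --> y -> (\forall i \near F, 0 <=v x i) -> 0 <=v y.
Proof.
move=> xy x0; pose yn := vjoin (- y) 0.
have yn0 : 0 <=v yn by exact: vleUr.
suff: yn = 0.
  move=> yn_eq0; rewrite -[y]subr0 vsub_ge0.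
  by rewrite -(vleD2rE (- y)) subrr add0r -yn_eq0 vleUl.
apply/eqP; rewrite -normr_eq0 eq_le normr_ge0 andbT.
apply/ler_addgt0Pr => eps eps0; rewrite add0r.
near F => i.
apply: (@le_trans _ _ `|y - x i|).
  rewrite distrC -[`|x i - y|]norm_vabs; apply: vle_norm_ge0 => //.
  rewrite vleU vabs_ge0 andbT; apply: vle_trans (vleUl _ _).
  by rewrite -[X in X <=v _]add0r vleD2rE; near: i.
by apply: ltW; near: i; exact: (cvgr_dist_lt _ _ xy).
Unshelve. all: by end_near. Qed.

Lemma vle_limn_series (y : nat -> E) :
  (forall n, 0 <=v y n) -> cvgn (series y) ->
  forall n, y n <=v limn (series y).
Proof.
move=> y0 cy n; rewrite -vsub_ge0.
apply: (@vpos_closed _ \oo _ (fun m => series y m - y n)).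
  by apply: cvgB => //; exact: cvg_cst.
(* [series y m] sums the indices below [m], so it contains [y n] from [m = n.+1] on. *)
exists n.+1 => // m /= nm; rewrite seriesEnat /= big_mkord.
rewrite (bigD1 (Ordinal nm)) //= addrAC subrr add0r.
exact: vsum_ge0.
Qed.

(** The same [n] gives the radius and the multiple of [e], so that the negation yields a single
    sequence. *)
Lemma strong_unit_ball e : strong_unit e ->
  exists n : nat, forall x, 0 <=v x -> `|x| <= 2^-1 ^+ n -> x <=v e *+ n.
Proof.
move=> [e0 eP]; apply: contrapT => /forallNP h.
have {h} /choice[y yP] : forall n, exists x,
    [/\ 0 <=v x, `|x| <= 2^-1 ^+ n & ~ x <=v e *+ n].
  move=> n; have /existsNP[x /not_implyP[x0 /not_implyP[xn xe]]] := h n.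
  by exists x.
have y0 n : 0 <=v y n by case: (yP n).
have cy : cvgn (series y).
  apply: normed_cvg; apply: (@series_le_cvg _ _ (geometric 1 2^-1)).
  - by move=> n /=.
  - by move=> n /=; rewrite mul1r exprn_ge0 // invr_ge0.
  - by move=> n /=; rewrite mul1r; case: (yP n).
  - apply: is_cvg_geometric_series.
    by rewrite ger0_norm ?invr_ge0// invf_lt1 // ltr1n.
have ys := vle_limn_series y0 cy.
have [N yN] := eP _ (vle_trans _ _ _ (y0 0%N) (ys 0%N)).
by case: (yP N) => _ _; apply; apply: vle_trans yN.
Qed.

Lemma strong_unit_bounded e (M : R) : strong_unit e ->
  exists2 K : R, 1 <= K & forall x, `|x| <= M -> vabs x <=v K *: e.
Proof.
move=> ue; have [n nP] := strong_unit_ball ue.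
(* Scaling by [c] sends the ball of radius [M] into that of radius [2^-1 ^+ n]; [M] may have any
   sign, hence the positive denominator. *)
pose c : R := 2^-1 ^+ n / (`|M| + 1).
have M0 : 0 < `|M| + 1 by rewrite ltr_wpDl.
have c0 : 0 < c by rewrite divr_gt0 // exprn_gt0 // invr_gt0.
exists (1 + c^-1 * n%:R) => [|x xM].
  by rewrite lerDl mulr_ge0 // invr_ge0 ltW.
have : c *: vabs x <=v e *+ n.
  apply: nP; first by apply: vscale_ge0; [exact: ltW|exact: vabs_ge0].
  rewrite normrZ norm_vabs gtr0_norm // /c -mulrA.
  rewrite ler_piMr ?exprn_ge0 ?invr_ge0 //.
  rewrite ler_pdivrMl // mulr1 (le_trans xM) // (le_trans (ler_norm M)) //.
  by rewrite lerDl.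
have ci0 : 0 <= c^-1 by rewrite invr_ge0 ltW.
move=> /(vle_scale ci0); rewrite scalerA mulVf ?gt_eqF // scale1r => xe.
apply: (vle_trans _ _ _ xe); rewrite -scaler_nat scalerA.
by apply: vle_scaler; [rewrite lerDr|case: ue].
Qed.

(** The element [K^-1 *: vabs x] is below [vabs x] since [1 <= K], and below [e], hence below their
    meet. *)
Lemma norm_le_vmeet e (K : R) x : 0 <=v e -> 1 <= K -> vabs x <=v K *: e ->
  `|x| <= K * `|vmeet (vabs x) e|.
Proof.
move=> e0 K1 xK; have K0 : 0 < K by exact: lt_le_trans K1.
have Ki0 : 0 <= K^-1 by rewrite invr_ge0 ltW.
rewrite -ler_pdivrMl // -[K^-1]ger0_norm // -norm_vabs -normrZ.
apply: vle_norm_ge0; first exact/vscale_ge0/vabs_ge0.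
rewrite vleI; apply/andP; split.
  rewrite -[X in _ <=v X]scale1r; apply: vle_scaler; last exact: vabs_ge0.
  by rewrite invf_le1.
by have := vle_scale Ki0 xK; rewrite scalerA mulVf ?gt_eqF // scale1r.
Qed.

End BanachLatticeTheory.

Lemma tails_proper (I : Type) (le : I -> I -> Prop) :
  directed le -> ProperFilter (tails le).
Proof.
move=> [[i0] refl trans dir]; split.
  by move=> [i /(_ i (refl i))].
split.
- by exists i0.
- move=> P Q [i iP] [j jQ]; have [k ik jk] := dir i j.
  exists k => l kl; split; first exact/iP/(trans _ _ _ ik).
  exact/jQ/(trans _ _ _ jk).
- by move=> P Q PQ [i iP]; exists i => j /iP; exact: PQ.
Qed.

(** * Comparison of the norm dual with the un-dual *)

Section Duals.
Context {R : realType} {E : banachLatticeType R}.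

Lemma norm_cvg_un_cvg {I : Type} {le : I -> I -> Prop} (x : I -> E) :
  directed le -> x i @[i --> tails le] --> (0 : E) -> un_cvg le x 0.
Proof.
move=> dir x0 u u0; have FF := tails_proper dir.
apply: (@squeeze_cvgr _ _ _ _ (fun=> 0) (fun i => `|x i|)).
- apply: nearW => i; rewrite normr_ge0 /= subr0 -[leRHS]norm_vabs.
  apply: vle_norm_ge0; last exact: vleIl.
  exact/vmeet_ge0/u0/vabs_ge0.
- exact: cvg_cst.
- by rewrite -(@normr0 _ E); exact: cvg_norm.
Qed.

(** It is enough to test un-convergence at [u = e], since the bound [M] gives one factor [K] for the
    whole net. *)
Lemma strong_unit_un_cvg {I : Type} {le : I -> I -> Prop} (x : I -> E) (e : E)
    (M : R) : strong_unit e -> directed le -> (forall i, `|x i| <= M) ->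
  un_cvg le x 0 -> x i @[i --> tails le] --> (0 : E).
Proof.
move=> ue dir xM x0; have FF := tails_proper dir.
have [K K1 xK] := strong_unit_bounded M ue.
apply/cvgr0Pnorm_le => eps eps0; have K0 : 0 < K by exact: lt_le_trans K1.
have /cvgr0Pnorm_le/(_ (K^-1 * eps)) := x0 e (proj1 ue).
rewrite mulr_gt0 ?invr_gt0 // => /(_ isT).
apply: filterS => i; rewrite normr_id subr0 ler_pdivlMl // => xe.
by apply: le_trans xe; apply: norm_le_vmeet; [case: ue| |exact: xK].
Qed.

(* The net indexed by all pairs [(y, r)] with [`|y| <= r <= 1], ordered by
   decreasing [r], has the balls around [0] as images of its tails. *)
Lemma un_dual_norm_dual : un_dual E `<=` norm_dual E.
Proof.
move=> f unf; pose I := {p : E * R | [/\ `|p.1| <= p.2, 0 < p.2 & p.2 <= 1]}.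
pose le (p q : I) := (sval q).2 <= (sval p).2.
pose x (p : I) := (sval p).1.
have ball0 (r : R) : 0 < r -> r <= 1 ->
    [/\ `|(0 : E, r).1| <= r, 0 < r & r <= 1].
  by move=> r0 r1; rewrite normr0; split => //; exact: ltW.
have dir : directed le.
  split.
  - by constructor; exists (0, 1); exact: ball0.
  - by move=> i; rewrite /le.
  - by move=> i j k ij jk; exact: le_trans ij.
  - move=> i j; case: (leP (sval i).2 (sval j).2) => ij.
      by exists i; rewrite /le.
    by exists j; rewrite /le // ltW.
have FF := tails_proper dir.
(* The cap [r <= 1] on the radii makes the net norm bounded. *)
have xM : exists M : R, forall i, `|x i| <= M.
  by exists 1 => -[p [p1 p2 p3]]; exact: (le_trans p1 p3).
have x0 : x i @[i --> tails le] --> (0 : E).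
  apply/cvgr0Pnorm_le => eps eps0.
  have m0 : 0 < Num.min eps 1 by rewrite lt_min eps0 ltr01.
  have m1 : Num.min eps 1 <= 1 by rewrite ge_min lexx orbT.
  exists (exist _ (0, Num.min eps 1) (ball0 _ m0 m1)) => -[p [p1 p2 p3]].
  by rewrite /le /x /= le_min => /andP[pe _]; exact: (le_trans p1 pe).
have /cvgr0Pnorm_le fx0 := unf I le x dir xM (norm_cvg_un_cvg dir x0).
apply: continuousfor0_continuous; rewrite /prop_for /continuous_at linear0.
(* The tail at [(y, r)] contains [(z, r)] for every [z] of norm less than [r], so the bound on [f]
   holds on that ball. *)
apply/cvgr0Pnorm_le => eps /fx0[[[y r] [/= yr r0 r1]] fr].
apply/nbhs_norm0P; exists r => //= z /= zr.
by have := fr (exist _ (z, r) (And3 (ltW zr) r0 r1)); apply; rewrite /le /=.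
Qed.

Lemma norm_dual_un_dual (e : E) : strong_unit e -> norm_dual E `<=` un_dual E.
Proof.
move=> ue f cf I le x dir [M xM] x0; have FF := tails_proper dir.
rewrite -(linear0 f); apply: (@continuous_cvg _ _ _ _ _ _ f); first exact: cf.
exact: strong_unit_un_cvg ue dir xM x0.
Qed.

End Duals.

Theorem proposition2p8 (R : realType) (E : banachLatticeType R) :
  (exists e : E, strong_unit e) ->
  tau_w E = tau_wun E.
Proof.
(* Both topologies come from one construction, so equality of the two sets of functionals
   suffices. *)
move=> [e ue]; rewrite /tau_w /tau_wun; congr (@open (functional_topology _)).
by apply/seteqP; split; [exact: norm_dual_un_dual ue|exact: un_dual_norm_dual].
Qed.
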